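(* For every integer $n\ge 3$ and every pair of distinct edges $e,f$ of $K_n$, $$\mathbf{P}(e\in F_n \text{ and } f\in F_n)<\mathbf{P}(e\in F_n)\,\mathbf{P}(f\in F_n),$$ where $F_n$ is a uniformly random forest of $K_n$.
   Context: $K_n$ is the simple complete graph on the vertex set $[n]=\{1,\dots,n\}$. A forest of $K_n$ is an acyclic subset of the edge set of $K_n$ (isolated vertices are permitted, the empty set is included, and there is no connectivity or spanning requirement). $F_n$ is chosen uniformly at random from the set of all forests of $K_n$. *)

(* Defs.v *)
From HB Require Import structures.
From mathcomp Require Import all_boot all_order all_algebra.
Set Implicit Arguments.
Unset Strict Implicit.
Unset Printing Implicit Defensive.
Import Order.TTheory GRing.Theory Num.Theory.
Local Open Scope ring_scope.

(* The vertex set [n] is 'I_n and an edge is a two-element set of vertices. *)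
Definition Kn_edges (n : nat) : {set {set 'I_n}} := [set e : {set 'I_n} | #|e| == 2%N].

Definition adj (n : nat) (F : {set {set 'I_n}}) : rel 'I_n :=
  fun x y => (x != y) && ([set x; y] \in F).

(* A cycle is a cyclic sequence of at least three distinct vertices, with
   consecutive vertices adjacent. Its length is at most n, so acyclicity can be
   given as a boolean; acyclicP quantifies over all sequences. *)
Definition acyclic (n : nat) (F : {set {set 'I_n}}) : bool :=
  [forall k : 'I_n.+1, forall c : k.-tuple 'I_n,
     ~~ [&& (2 < k)%N, uniq c & cycle (adj F) c]].

Lemma acyclicP (n : nat) (F : {set {set 'I_n}}) :
  reflect (forall c : seq 'I_n, (2 < size c)%N -> uniq c -> ~~ cycle (adj F) c)
          (acyclic F).
Proof.
apply: (iffP forallP) => [acF c c_gt2 Uc | acF k].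
  have c_le : (size c < n.+1)%N.
    by rewrite ltnS -[X in (_ <= X)%N]card_ord -(card_uniqP Uc) max_card.
  have /forallP/(_ (in_tuple c)) := acF (Ordinal c_le).
  by rewrite /= c_gt2 Uc.
apply/forallP=> c; apply/negP=> /and3P[k_gt2 Uc].
by apply/negP; apply: acF; rewrite ?size_tuple.
Qed.

Definition forests (n : nat) : {set {set {set 'I_n}}} :=
  [set F : {set {set 'I_n}} | (F \subset Kn_edges n) && acyclic F].

Lemma forests0 (n : nat) : set0 \in forests n.
Proof.
rewrite inE sub0set; apply/acyclicP=> -[|x [|y c]] //= _ _.
by rewrite /adj in_set0 andbF.
Qed.

(* The probability of the event A for a uniformly random forest of K_n; the
   denominator is nonzero by forests0. *)
Definition forest_prob (n : nat) (A : pred {set {set 'I_n}}) : rat :=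
  #|[set F in forests n | A F]|%:R / #|forests n|%:R.

(* Main.v *)
Require Import Defs.
From HB Require Import structures.
From mathcomp Require Import all_boot all_order all_algebra.
From mathcomp Require Import zify ring.
Set Implicit Arguments.
Unset Strict Implicit.
Unset Printing Implicit Defensive.
Import Order.TTheory GRing.Theory Num.Theory.
Local Open Scope ring_scope.

(** Everything is counted through forests [G] that keep given vertices apart.
    Removing the edge [ab] from a forest gives a forest with [a] and [b] in different
    components, and this is a bijection (lemma [card_forests_edge]). So, up to the
    common denominator, the three probabilities count forests [G] in which a few
    named vertices satisfy a condition that mentions only which of them are connected.

    Two families of numbers describe such conditions. For a list [s] of [k] distinct
    vertices, let [q] count the forests in which the vertices of [s] lie in different
    components; for [v] in [s] and [d] outside [s], let [t] count those in which
    moreover [d] lies in the component of [v]. Then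
      - [q(s) = q(d :: s) + sum over v in s of t(s, v, d)], according to the component
        of [d] (lemma [separating_rec]);
      - [t(s, v, d) = q(d :: s) + sum over w outside d :: s of t(w :: s, w, d)]: delete
        the first edge [vw] of the path from [v] to [d]; then [w] is separated from
        [s] and still connected to [d], and adding [vw] back recovers the forest
        (lemma [attaching_rec]).
    When [s] contains all vertices only the empty forest remains. Hence downward
    induction on [k] shows that [q] and [t] depend on [k] alone, with
      [q_k = q_(k+1) + k t_k]   and   [t_k = q_(k+1) + (n - k - 1) t_(k+1)].

    There are [q_0 = q_1] forests, [q_2] of them contain a given edge, [q_3] contain
    two given edges with a common vertex, and [q_4 + 4 t_3] contain two given disjoint
    edges. As [q_3 = q_4 + 3 t_3], it remains to see that
    [q_1 (q_4 + 4 t_3) < q_2 ^ 2]. The recurrences express all these numbers through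
    [q_6] and [(n - 6) t_6], and for [n >= 6] the difference of the two sides is a
    quadratic form in these two whose coefficients are polynomials in [n - 6] with
    positive coefficients; this is [sepn_polynomial_bound]. The cases [n < 6] are
    finite computations. *)

(** * Connectivity and single edges *)

Section Connectivity.
Local Open Scope nat_scope.
Variable n : nat.
Implicit Types (F G : {set {set 'I_n}}) (a b c d v w x y z : 'I_n).
Implicit Types (s p : seq 'I_n).

Definition conn F : rel 'I_n := connect (adj F).

Lemma adj_sym F : symmetric (adj F).
Proof. by move=> x y; rewrite /adj eq_sym setUC. Qed.

Lemma conn_refl F x : conn F x x.
Proof. exact: connect0. Qed.

Lemma conn_sym F x y : conn F x y = conn F y x.
Proof. exact/sym_connect_sym/adj_sym. Qed.

Lemma conn_trans F y x z : conn F x y -> conn F y z -> conn F x z.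
Proof. exact: connect_trans. Qed.

Lemma adj_mono F G x y : F \subset G -> adj F x y -> adj G x y.
Proof. by move=> sFG /andP[nxy /(subsetP sFG) ?]; apply/andP. Qed.

Lemma conn_mono F G x y : F \subset G -> conn F x y -> conn G x y.
Proof.
by move=> sFG; apply: connect_sub => u v Fuv; apply/connect1/(adj_mono sFG).
Qed.

Lemma eq_set2 x y a b :
  ([set x; y] == [set a; b]) = ((x == a) && (y == b)) || ((x == b) && (y == a)).
Proof.
apply/eqP/orP => [/setP E|[]/andP[/eqP-> /eqP->] //]; last exact: setUC.
move: (E x) (E y) (E a) (E b); rewrite !inE !eqxx !(eq_sym a) !(eq_sym b) !orbT /=.
case: (x == a); case: (x == b); case: (y == a); case: (y == b) => //=; auto.
Qed.

(** All later connectivity arguments reduce to this case distinction: a walk in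
    [F + ab] either avoids [ab], or can be taken to cross it once, in one of the two
    directions. *)
Lemma connU1 F a b x y : a != b ->
  conn ([set a; b] |: F) x y =
  [|| conn F x y, conn F x a && conn F b y | conn F x b && conn F a y].
Proof.
move=> nab; have sub := @conn_mono F _ _ _ (subsetUr [set [set a; b]] F).
have Gab : conn ([set a; b] |: F) a b.
  by apply: connect1; rewrite /adj nab !inE eqxx.
apply/idP/idP; last first.
  case/or3P => [/sub //|/andP[/sub xa /sub yb]|/andP[/sub xb /sub ay]].
    exact: conn_trans xa (conn_trans Gab yb).
  by apply: conn_trans xb (conn_trans _ ay); rewrite conn_sym.
case/connectP => p; elim: p x => [|z p IH] x /=; first by move=> _ ->; rewrite conn_refl.
case/andP => /andP[nxz]; rewrite in_setU1 eq_set2 => xz pz /(IH _ pz){IH pz}.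
case/orP: xz => [/orP[]/andP[/eqP-> /eqP->]|Fxz].
1,2: by rewrite !conn_refl; case: (conn F b y); case: (conn F a y);
  rewrite ?andbF ?orbT.
have /conn_trans tr : conn F x z by apply: connect1; rewrite /adj nxz.
by case/or3P => [/tr->|/andP[/tr-> ->]|/andP[/tr-> ->]]; rewrite /= ?orbT.
Qed.

(** Used to drop one edge of a repetition-free path or cycle: the rest of it avoids one
    end of that edge, hence survives without the edge. *)
Lemma path_avoid F x y z p : y \notin z :: p -> path (adj F) z p ->
  path (adj (F :\ [set x; y])) z p.
Proof.
elim: p z => //= u p IH z; rewrite inE negb_or => /andP[nyz yp] /andP[Fzu Fp].
rewrite IH // andbT; case/andP: Fzu => nzu Fzu; rewrite /adj nzu !inE Fzu andbT.
move: yp; rewrite inE negb_or eq_set2 => /andP[nyu _].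
by rewrite (eq_sym z y) (eq_sym u y) (negbTE nyz) (negbTE nyu) andbF.
Qed.

(** A cycle of [F + ab] outside [F] is the edge [ab] together with a path from [a]
    to [b] in [F]. *)
Lemma acyclicU1 F a b : a != b -> [set a; b] \notin F ->
  acyclic ([set a; b] |: F) = acyclic F && ~~ conn F a b.
Proof.
move=> nab abF; have sF := subsetUr [set [set a; b]] F.
apply/idP/andP => [/acyclicP acG|[/acyclicP acF nF]].
  split.
    apply/acyclicP => c c3 Uc; apply: contra (acG c c3 Uc).
    by apply: sub_cycle => x y; apply: adj_mono.
  apply/negP => /connectP[p Fp lp].
  case/shortenP: Fp lp => {}p Fp Up _ lp.
  have /negP[] : ~~ cycle (adj ([set a; b] |: F)) (a :: p).
    apply: acG => //; case: p Fp lp {Up} => [|z [|? ?]] //= Fz Ez.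
      by rewrite Ez eqxx in nab.
    by move: Fz abF; rewrite Ez /adj => /andP[/andP[_ ->]].
  rewrite /= rcons_path -lp (sub_path _ Fp) => [|x y]; last exact: adj_mono.
  by rewrite /adj eq_sym nab setUC !inE eqxx.
apply/acyclicP => c c3 Uc; apply/negP => Gc.
have /negP[] := acF c c3 Uc.
(* An edge of the cycle missing from [F] is [ab]; going round the rest of the cycle
   connects its two ends in [F]. *)
apply: cycle_from_next => // x xc; have := next_cycle Gc xc.
rewrite /adj => /andP[nxy]; rewrite nxy in_setU1 => /orP[/eqP Exy|//].
case/negP: nF; suff: conn F x (next c x).
  have := eqxx [set x; next c x]; rewrite {2}Exy eq_set2.
  by case/orP=> /andP[/eqP-> /eqP->] //; rewrite conn_sym.
case/rot_to: xc => i [|y p] rc; first by move: c3; rewrite -(size_rot i) rc.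
have Ey : next c x = y by rewrite -(next_rot i Uc) rc /= eqxx.
move: c3 Uc Gc; rewrite Ey in Exy *; rewrite -(size_rot i) -(rot_uniq i) -(rot_cycle i).
rewrite {}rc => c3 /andP[xp Up] /= /andP[Gxy]; rewrite rcons_path => /andP[Gp Gl].
have sub u v : adj (([set a; b] |: F) :\ [set y; x]) u v -> adj F u v.
  by apply: adj_mono; rewrite [[set y; x]]setUC Exy setU1K.
rewrite conn_sym; apply/connectP; exists (rcons p x); last by rewrite last_rcons.
rewrite rcons_path (sub_path sub (path_avoid y xp Gp)) /=.
apply: sub; case/andP: Gl => nlx Gl; rewrite /adj nlx in_setD1 Gl andbT.
rewrite eq_set2 eqxx andbT negb_or negb_and nlx andbT.
case: p c3 Up {Gp xp Gl nlx} => // z p _ /= /andP[yp _].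
by apply: contraNneq yp => <-; apply: mem_last.
Qed.

Lemma forestsU1 F a b : a != b -> [set a; b] \notin F ->
  ([set a; b] |: F \in forests n) = (F \in forests n) && ~~ conn F a b.
Proof.
move=> nab abF; rewrite !inE acyclicU1 // subUset sub1set inE cards2 nab /=.
by rewrite andbA.
Qed.

Lemma conn_edge F a b : a != b -> [set a; b] \in F -> conn F a b.
Proof. by move=> nab abF; apply: connect1; rewrite /adj nab. Qed.

Lemma forest_edge_neq F a b : F \in forests n -> [set a; b] \in F -> a != b.
Proof.
rewrite inE => /andP[/subsetP sF _] /sF; rewrite inE cards2.
by case: (a =P b).
Qed.

Lemma forestsD1 F a b : F \in forests n -> [set a; b] \in F ->
  F :\ [set a; b] \in forests n /\ ~~ conn (F :\ [set a; b]) a b.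
Proof.
move=> fF abF; apply/andP; rewrite -forestsU1 ?setD1K //; last by rewrite !inE eqxx.
exact: forest_edge_neq abF.
Qed.

(** The map [F |-> F - ab] is a bijection from the forests that contain [ab] onto the
    forests that separate [a] from [b]; the predicate [P] carries any further
    condition across it. *)
Lemma card_forests_edge a b (P : pred {set {set 'I_n}}) : a != b ->
  #|[set F in forests n | ([set a; b] \in F) && P (F :\ [set a; b])]| =
  #|[set G in forests n | ~~ conn G a b && P G]|.
Proof.
move=> nab.
have notin G : ~~ conn G a b -> [set a; b] \notin G.
  by apply: contraNN; apply: conn_edge.
rewrite -[RHS](@card_in_imset _ _ (setU [set [set a; b]])).
  apply: eq_card => F; apply/idP/imsetP => [|[G]].
    rewrite inE => /and3P[fF abF PF]; have [fG nG] := forestsD1 fF abF.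
    by exists (F :\ [set a; b]); rewrite ?setD1K // inE fG nG PF.
  rewrite [G \in _]inE => /and3P[fG nG PG] ->; have abG := notin _ nG.
  by rewrite inE forestsU1 // fG nG !inE eqxx setU1K.
move=> G H; rewrite [G \in _]in_set [H \in _]in_set.
move=> /and3P[_ /notin nG _] /and3P[_ /notin nH _] E.
by rewrite -(setU1K nG) E setU1K.
Qed.

(** * Forests that separate given vertices *)

(** A list, not a set: on an explicit list [pairwise] unfolds to the conjunction of the
    conditions on the pairs. *)
Definition indep G s := pairwise (fun x y => ~~ conn G x y) s.

Lemma indepP G s : uniq s ->
  reflect {in s &, forall x y, conn G x y -> x = y} (indep G s).
Proof.
elim: s => [|d s IH] /=; first by left.
case/andP => ds Us; rewrite -/(indep G s).
apply: (iffP andP) => [[/allP Gd /(IH Us) Is] x y|Is].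
  rewrite !inE => /predU1P[->|xs] /predU1P[->|ys] //; last exact: Is.
    by move=> Gdy; have := Gd _ ys; rewrite Gdy.
  by rewrite conn_sym => Gdx; have := Gd _ xs; rewrite Gdx.
split.
  apply/allP => v vs; apply: contraNN ds => /Is.
  by rewrite !inE eqxx vs orbT => ->.
by apply/(IH Us) => x y xs ys; apply: Is; rewrite inE ?xs ?ys orbT.
Qed.

Definition separating s := #|[set G in forests n | indep G s]|.

Definition attaching s v d :=
  #|[set G in forests n | indep G s && conn G v d]|.

Lemma card_forests_sum (P : pred {set {set 'I_n}}) :
  #|[set G in forests n | P G]| = \sum_(G in forests n) P G.
Proof. by rewrite -sum1dep_card big_mkcondr. Qed.

(** Either [d] is separated from all of [s], or it lies in the component of exactly
    one vertex of [s]. *)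
Lemma separating_rec s d : uniq s -> d \notin s ->
  separating s = separating (d :: s) + \sum_(v <- s) attaching s v d.
Proof.
move=> Us ds; rewrite /separating /attaching !card_forests_sum.
under [X in _ + X]eq_bigr do rewrite card_forests_sum.
rewrite exchange_big -big_split; apply: eq_bigr => G _ /=.
rewrite -/(indep G s); have [Is|_] := boolP (indep G s); last first.
  by rewrite andbF big1.
rewrite andbT; case: allP => [nd|/allP/allPn[v vs /negPn dv]].
  rewrite big_seq big1 // => v vs; rewrite conn_sym.
  by rewrite (negbTE (nd _ vs)).
rewrite (bigD1_seq v) //= conn_sym dv big_seq_cond big1 // => w /andP[ws nwv].
case Gwd: (conn G w d) => //; case/eqP: nwv.
by apply: (indepP G Us Is) => //; apply: conn_trans dv.
Qed.

Lemma first_step G v d : G \in forests n -> v != d -> conn G v d ->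
  exists2 w, [set v; w] \in G & conn (G :\ [set v; w]) w d.
Proof.
move=> fG nvd /connectP[p Gp lp]; case/shortenP: Gp lp => -[|w q] /= Gq Uq _ ld.
  by rewrite ld eqxx in nvd.
case/andP: Gq => /andP[nvw Gvw] Gq; exists w => //; apply/connectP; exists q => //.
by rewrite setUC; apply: path_avoid => //; case/andP: Uq.
Qed.

(** In a forest the first edge of the way from [v] to [d] is unique. With two
    candidates [vw] and [vw'], delete both: since each is a bridge, [w], [w'] and [v]
    are pairwise separated in what remains, while [d] is connected to both [w] and
    [w']. *)
Lemma first_step_uniq G v d w w' : G \in forests n ->
  [set v; w] \in G -> conn (G :\ [set v; w]) w d ->
  [set v; w'] \in G -> conn (G :\ [set v; w']) w' d -> w = w'.
Proof.
move=> fG Gw wd Gw' wd'; apply/eqP/negPn/negP => nww'.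
have nvw := forest_edge_neq fG Gw; have nvw' := forest_edge_neq fG Gw'.
have [[_ sw] [_ sw']] := (forestsD1 fG Gw, forestsD1 fG Gw').
have nE : [set v; w] != [set v; w'].
  by rewrite eq_set2 eqxx (negbTE nww') (negbTE nvw').
pose H := G :\ [set v; w] :\ [set v; w'].
have E : G :\ [set v; w] = [set v; w'] |: H.
  by rewrite setD1K // !inE eq_sym nE.
have E' : G :\ [set v; w'] = [set v; w] |: H.
  by rewrite /H setDDl [_ :|: [set [set v; w']]]setUC -setDDl setD1K // !inE nE.
move: sw sw' wd wd'; rewrite E E' !connU1 // !conn_refl !negb_or /=.
rewrite !(conn_sym _ w v) !(conn_sym _ w' v) (conn_sym _ w' w).
case/and3P=> /negbTE-> /negbTE nw _ /and3P[/negbTE-> _ _].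
rewrite nw /= !orbF => wd wd'; move: nw; rewrite (conn_trans wd) //.
by rewrite conn_sym.
Qed.

Lemma first_step_notin G s v w : G \in forests n -> uniq s -> indep G s ->
  v \in s -> [set v; w] \in G -> w \notin s.
Proof.
move=> fG Us Is vs Gvw; apply/negP => ws.
have nvw := forest_edge_neq fG Gvw; case/eqP: (nvw).
exact: (indepP G Us Is) (conn_edge nvw Gvw).
Qed.

(** Contracting the edge [vw] merges [w] into [v], so that separating [s] in [G + vw]
    amounts to separating [w :: s] in [G]. *)
Lemma indep_edge G s v w : uniq s -> v \in s -> w \notin s ->
  ~~ conn G v w && indep ([set v; w] |: G) s = indep G (w :: s).
Proof.
move=> Us vs ws; have Uws : uniq (w :: s) by rewrite /= ws.
have nvw : v != w by apply: contraNneq ws => <-.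
apply/andP/(indepP G Uws) => [[nG /(indepP _ Us) Is] x y|Is].
  have aux z : z \in s -> conn G w z = false.
    move=> zs; apply/negP => wz; case/negP: nG.
    suff -> : v = z by rewrite conn_sym.
    by apply: Is => //; rewrite connU1 // conn_refl wz orbT.
  rewrite !inE => /predU1P[->|xs] /predU1P[->|ys] //; first by rewrite aux.
    by rewrite conn_sym aux.
  by move=> Gxy; apply: Is => //; rewrite connU1 // Gxy.
split; first by apply: contraNN nvw => /Is; rewrite !inE eqxx vs orbT => ->.
apply/(indepP _ Us) => x y xs ys; rewrite connU1 //.
have aux z : z \in s -> conn G w z = false.
  move=> zs; apply/negP => /Is; rewrite !inE eqxx zs orbT => /(_ isT isT) E.
  by rewrite E zs in ws.
rewrite [conn G x w]conn_sym !aux // andbF !orbF.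
by apply: Is; rewrite inE ?xs ?ys orbT.
Qed.

(** Sort the forests by the first vertex [w] on the way from [v] to [d], then delete
    the edge [vw]. The term [w = d] imposes no condition besides separation, which
    gives [separating (d :: s)]. *)
Lemma attaching_rec s v d : uniq s -> v \in s -> d \notin s ->
  attaching s v d = separating (d :: s) +
    \sum_(w | w \notin d :: s) attaching (w :: s) w d.
Proof.
move=> Us vs ds; have nvd : v != d by apply: contraNneq ds => <-.
pose step w G := ([set v; w] \in G) && conn (G :\ [set v; w]) w d.
transitivity (\sum_(w | w \notin s)
    #|[set G in forests n | indep G s && step w G]|).
  rewrite /attaching card_forests_sum.
  under [RHS]eq_bigr do rewrite card_forests_sum.
  rewrite exchange_big; apply: eq_bigr => G fG /=.
  have [Is|_] := boolP (indep G s); last by rewrite big1.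
  have [Gvd|nGvd] /= := boolP (conn G v d).
    have [w Gw wd] := first_step fG nvd Gvd.
    rewrite (bigD1 w) /=; last exact: first_step_notin Gw.
    rewrite {1}/step Gw wd big1 // => w' /andP[_]; apply: contraNeq.
    rewrite eqb0 negbK => /andP[Gw' wd'].
    by apply/eqP; apply: (first_step_uniq fG Gw' wd' Gw).
  rewrite big1 // => w _; apply/eqP; rewrite eqb0; apply: contraNN nGvd.
  case/andP => Gw /(conn_mono (subsetDl _ _)); apply: conn_trans.
  exact: conn_edge (forest_edge_neq fG Gw) Gw.
have move_step w : w \notin s ->
  #|[set G in forests n | indep G s && step w G]| = attaching (w :: s) w d.
  move=> ws; have nvw : v != w by apply: contraNneq ws => <-.
  have := card_forests_edge
    (fun H => indep ([set v; w] |: H) s && conn H w d) nvw.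
  rewrite /attaching; set X := [set G in _ | _ ]; set Y := [set G in _ | _ ].
  have -> : X = [set G in forests n | indep G s && step w G].
    apply/setP => G; rewrite !inE /step; congr (_ && _); rewrite andbCA.
    by have [Gw|] := boolP ([set v; w] \in G); [rewrite setD1K | rewrite !andbF].
  move=> ->; apply: eq_card => G; rewrite !inE.
  by congr (_ && _); rewrite andbA indep_edge.
rewrite (eq_bigr _ move_step) (bigD1 d) //=; congr (_ + _).
  by apply: eq_card => G; rewrite !inE conn_refl andbT.
by apply: eq_bigl => w; rewrite inE negb_or andbC.
Qed.

(** * The counts depend only on the number of separated vertices *)

(** The pair [(q_k, t_k)] for [k = n - j], computed from the number [j] of vertices
    outside the list. For [j = 0] no vertex is left to attach, and [t_n = 0] is a
    convention: it only enters multiplied by [0]. *)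
Fixpoint profile j : nat * nat :=
  if j is i.+1 then
    let: (q, t) := profile i in (q + (n - j) * (q + i * t), q + i * t)
  else (1, 0).

Definition sepn k := (profile (n - k)).1.
Definition attn k := (profile (n - k)).2.

Lemma attn_rec k : k < n -> attn k = sepn k.+1 + (n - k.+1) * attn k.+1.
Proof.
move=> kn; rewrite /attn /sepn -(subnSK kn) /=.
by case: profile.
Qed.

Lemma sepn_rec k : k < n -> sepn k = sepn k.+1 + k * attn k.
Proof.
move=> kn; rewrite /attn /sepn -(subnSK kn) /=; case: profile => q t /=.
by rewrite subnSK // subKn // ltnW.
Qed.

Lemma sepn_full : sepn n = 1.
Proof. by rewrite /sepn subnn. Qed.

Lemma separating_full s : uniq s -> size s = n -> separating s = 1.
Proof.
move=> Us sz; have all_s x : x \in s.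
  have -> // : s =i 'I_n.
  by apply/subset_cardP; rewrite ?subset_predT // (card_uniqP Us) card_ord.
rewrite /separating -(cards1 (set0 : {set {set 'I_n}})).
apply: eq_card => G; rewrite in_set in_set1; apply/andP/eqP => [[fG Is]|->].
  apply/eqP; rewrite -subset0; apply/subsetP => e eG.
  have /cards2P[x [y [nxy Ee]]] : #|e| == 2.
    by move: fG; rewrite inE => /andP[/subsetP/(_ _ eG)]; rewrite inE.
  by case/eqP: (nxy); apply: (indepP G Us Is) => //; apply: conn_edge => //; rewrite -Ee.
split; first exact: forests0.
apply/(indepP _ Us) => x y _ _ /connectP[[|z p] /=]; first by move=> _ ->.
by rewrite /adj in_set0 andbF.
Qed.

Lemma card_notin s : uniq s -> #|[pred w | w \notin s]| = n - size s.
Proof.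
move=> Us; have := cardC (mem s); rewrite card_ord (card_uniqP Us) => E.
by rewrite -[X in _ = X - _]E addKn.
Qed.

(** Downward induction on the size of [s]: the right-hand sides of [attaching_rec] and
    [separating_rec] only involve lists with one vertex more, and [attaching s]. *)
Lemma separating_attaching s : uniq s ->
  separating s = sepn (size s) /\
  {in s, forall v d, d \notin s -> attaching s v d = attn (size s)}.
Proof.
have size_le s' : uniq s' -> size s' <= n.
  by move=> Us'; rewrite -(card_uniqP Us') -[X in _ <= X]card_ord max_card.
have [j] := ubnP (n - size s); elim: j s => // j IH s le_j Us.
have [sz|sz] := eqVneq (size s) n.
  split=> [|v _ d ds]; first by rewrite separating_full // sz sepn_full.
  by have := size_le (d :: s); rewrite /= ds Us sz ltnn => /(_ isT).
have lt_sn : size s < n by rewrite ltn_neqAle sz size_le.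
have IHd d : d \notin s -> separating (d :: s) = sepn (size s).+1 /\
  {in d :: s, forall v w, w \notin d :: s ->
    attaching (d :: s) v w = attn (size s).+1}.
  by move=> ds; apply: (IH (d :: s)); rewrite /= ?ds //; lia.
have att : {in s, forall v d, d \notin s -> attaching s v d = attn (size s)}.
  move=> v vs d ds; rewrite attaching_rec // (IHd d ds).1 attn_rec //.
  congr (_ + _); rewrite (eq_bigr (fun=> attn (size s).+1)) => [|w].
    by rewrite sum_nat_const card_notin //= ds.
  rewrite inE negb_or => /andP[nwd ws]; apply: (IHd w ws).2; first exact: mem_head.
  by rewrite inE negb_or eq_sym nwd.
split=> //; have /card_gt0P[d] : 0 < #|[pred w | w \notin s]|.
  by rewrite card_notin // subn_gt0.
rewrite inE => ds.
rewrite (separating_rec Us ds) (IHd d ds).1 (sepn_rec lt_sn); congr (_ + _).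
rewrite big_seq (eq_bigr (fun=> attn (size s))) => [|v vs]; last exact: att.
by rewrite -big_seq big_const_seq count_predT iter_addn_0 mulnC.
Qed.

Lemma separating_size s : uniq s -> separating s = sepn (size s).
Proof. by case/separating_attaching. Qed.

Lemma attaching_size s v d : uniq s -> v \in s -> d \notin s ->
  attaching s v d = attn (size s).
Proof. by case/separating_attaching => _ att vs; apply: att. Qed.

(** * Forests that contain given edges *)

Lemma card_two_edges a b c d : a != b -> c != d -> [set a; b] != [set c; d] ->
  #|[set F in forests n | ([set a; b] \in F) && ([set c; d] \in F)]| =
  #|[set G in forests n | ~~ conn G c d && ~~ conn ([set c; d] |: G) a b]|.
Proof.
move=> nab ncd ne.
rewrite -(card_forests_edge (fun H => ~~ conn ([set c; d] |: H) a b)) //.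
transitivity #|[set G in forests n | ~~ conn G a b && ([set c; d] \in G)]|.
  rewrite -(card_forests_edge (fun H => [set c; d] \in H)) //.
  by apply: eq_card => F; rewrite !in_set in_set1 eq_sym ne.
apply: eq_card => G; rewrite !in_set; congr (_ && _); rewrite andbC.
by case: (boolP ([set c; d] \in G)) => // cdG; rewrite setD1K.
Qed.

Lemma card_one_edge a b : a != b ->
  #|[set F in forests n | [set a; b] \in F]| = sepn 2.
Proof.
move=> nab; rewrite -(separating_size (s := [:: a; b])) /= ?inE ?nab //.
transitivity #|[set G in forests n | ~~ conn G a b && predT G]|.
  by rewrite -card_forests_edge //; apply: eq_card => F; rewrite !inE andbT.
by apply: eq_card => G; rewrite !inE /= !andbT.
Qed.

Lemma card_adjacent_edges a b c : uniq [:: a; b; c] ->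
  #|[set F in forests n | ([set a; b] \in F) && ([set a; c] \in F)]| = sepn 3.
Proof.
move=> U; rewrite -(separating_size U); move: U.
rewrite /= !inE negb_or !andbT => /andP[/andP[nab nac] nbc].
rewrite card_two_edges //; last by rewrite eq_set2 eqxx (negbTE nbc) (negbTE nac).
apply: eq_card => G; rewrite !in_set /indep /= !andbT; congr (_ && _).
rewrite connU1 // conn_refl !negb_or /= (conn_sym _ c b).
by case: (conn G a b); case: (conn G a c); case: (conn G b c).
Qed.

(** After deleting both edges, the forests are those that separate [a] from [b] and
    [c] from [d] and have at most one connection between the two pairs: none, counted
    by [sepn 4], or one of the four possible ones, each counted by [attn 3]. *)
Lemma card_disjoint_edges a b c d : uniq [:: a; b; c; d] ->
  #|[set F in forests n | ([set a; b] \in F) && ([set c; d] \in F)]| =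
  sepn 4 + 4 * attn 3.
Proof.
move=> U; rewrite -(separating_size U); move: U.
rewrite /= !inE !negb_or !andbT -!andbA => /andP[nab /and5P[nac nad nbc nbd ncd]].
rewrite card_two_edges //; last by rewrite eq_set2 (negbTE nac) (negbTE nad).
have Uc : uniq [:: a; b; c] by rewrite /= !inE negb_or nab nac nbc.
have Ud : uniq [:: a; b; d] by rewrite /= !inE negb_or nab nad nbd.
have cn : c \notin [:: a; b; d] by rewrite !inE !negb_or ncd !(eq_sym c) nac nbc.
have dn : d \notin [:: a; b; c] by rewrite !inE !negb_or !(eq_sym d) nad nbd ncd.
have att s v x : uniq s -> size s = 3 -> v \in s -> x \notin s ->
    attaching s v x = attn 3.
  by move=> Us <-; apply: attaching_size.
have -> : 4 * attn 3 =
    attaching [:: a; b; d] a c + attaching [:: a; b; d] b c +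
    (attaching [:: a; b; c] a d + attaching [:: a; b; c] b d).
  by rewrite !att // ?inE ?eqxx ?orbT // !mulSn addn0 !addnA.
rewrite /separating /attaching !card_forests_sum -!big_split.
apply: eq_bigr => G _; rewrite connU1 // /indep /= !andbT !negb_or.
have tr x y z : conn G x y && conn G y z ==> conn G x z.
  by apply/implyP => /andP[]; apply: conn_trans.
(* A check over the values of the six connections that respect transitivity. *)
move: (tr a b c) (tr b a c) (tr a c b) (tr a b d) (tr b a d) (tr a d b).
move: (tr a c d) (tr c a d) (tr a d c) (tr b c d) (tr c b d) (tr b d c).
rewrite ?(conn_sym G b a) ?(conn_sym G c a) ?(conn_sym G d a).
rewrite ?(conn_sym G c b) ?(conn_sym G d b) ?(conn_sym G d c).
by do 6 case: (conn G _ _) => //=.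
Qed.

Lemma sepn_gt0 k : 0 < sepn k.
Proof.
rewrite /sepn; elim: (n - k) => //= j; case: profile => q t /= q_gt0.
by rewrite addn_gt0 q_gt0.
Qed.

End Connectivity.

(** * The inequalities between the counts *)

(** Here [m = n - 6], [q = q_6] and [u = (n - 6) t_6]. Stopping at index 6 matters: the
    same expansion in terms of [q_5] and [(n - 5) t_5], or of [q_4] and [(n - 4) t_4],
    has negative coefficients. *)
Lemma sepn_polynomial_bound (m q u t5 q5 t4 q4 t3 q3 t2 q2 t1 q1 : nat) : (0 < q ->
  t5 = q + u -> q5 = q + 5 * t5 ->
  t4 = q5 + (m + 1) * t5 -> q4 = q5 + 4 * t4 ->
  t3 = q4 + (m + 2) * t4 -> q3 = q4 + 3 * t3 ->
  t2 = q3 + (m + 3) * t3 -> q2 = q3 + 2 * t2 ->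
  t1 = q2 + (m + 4) * t2 -> q1 = q2 + t1 ->
  q1 * (q4 + 4 * t3) < q2 ^ 2)%N.
Proof.
move=> q_gt0 Et5 Eq5 Et4 Eq4 Et3 Eq3 Et2 Eq2 Et1 Eq1.
(* The large constants are factored because numerals of type [nat] are unary. *)
have -> : (q2 ^ 2 = q1 * (q4 + 4 * t3) +
    (q ^ 2 * (3 * m ^ 4 + 112 * m ^ 3 + 1309 * m ^ 2 + 28 * 239 * m + 52 * 251)
     + q * u * (7 * m ^ 4 + 227 * m ^ 3 + 2462 * m ^ 2 + 50 * 239 * m + 132 * 169)
     + u ^ 2 * (4 * m ^ 4 + 114 * m ^ 3 + 1153 * m ^ 2 + 75 * 71 * m + 4 * 2383)))%N.
  by rewrite Eq1 Et1 Eq2 Et2 Eq3 Et3 Eq4 Et4 Eq5 Et5; ring.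
rewrite -[X in (X < _)%N]addn0 ltn_add2l -addnA ltn_addr // muln_gt0 expn_gt0 q_gt0.
by rewrite addn_gt0 orbT.
Qed.

(** For [n = 4] and [n = 5] both sides are computed; for [n = 4] they are 190 and 196. *)
Lemma disjoint_edges_bound n : (3 < n)%N ->
  (sepn n 1 * (sepn n 4 + 4 * attn n 3) < sepn n 2 ^ 2)%N.
Proof.
case: n => [|[|[|[|[|[|m]]]]]] // _.
set n := m.+4.+2.
have sep_step k : (k < 6)%N -> sepn n k = (sepn n k.+1 + k * attn n k)%N.
  by move=> k_lt6; apply: sepn_rec; rewrite /n; lia.
have att_step k : (k < 6)%N ->
    attn n k = (sepn n k.+1 + (m + (5 - k)) * attn n k.+1)%N.
  move=> k_lt6; rewrite attn_rec; last by rewrite /n; lia.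
  by congr (_ + _ * _)%N; rewrite /n; lia.
apply: (@sepn_polynomial_bound m (sepn n 6) (m * attn n 6) (attn n 5) (sepn n 5)
          (attn n 4) _ _ (sepn n 3) (attn n 2) _ (attn n 1)).
- exact: sepn_gt0.
- by rewrite (att_step 5) // addn0.
- exact: sep_step.
- exact: (att_step 4).
- exact: sep_step.
- exact: (att_step 3).
- exact: sep_step.
- exact: (att_step 2).
- exact: sep_step.
- exact: (att_step 1).
by rewrite (sep_step 1) // mul1n.
Qed.

(** For [n >= 4] this follows from the bound for disjoint edges, since
    [q_3 = q_4 + 3 t_3]; for [n = 3] there are no disjoint edges and the numbers are
    [7 * 1 < 3 ^ 2]. *)
Lemma adjacent_edges_bound n : (2 < n)%N ->
  (sepn n 1 * sepn n 3 < sepn n 2 ^ 2)%N.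
Proof.
rewrite leq_eqVlt => /predU1P[<- // | n_gt3].
apply: leq_ltn_trans (disjoint_edges_bound n_gt3).
by rewrite leq_mul2l (sepn_rec n_gt3) leq_add2l leq_mul2r orbT orbT.
Qed.

Lemma card_edge_pair_bound n (e f : {set 'I_n}) : (2 < n)%N ->
  e \in Kn_edges n -> f \in Kn_edges n -> e != f ->
  (sepn n 1 * #|[set F in forests n | (e \in F) && (f \in F)]| < sepn n 2 ^ 2)%N.
Proof.
move=> n_gt2; rewrite !inE => /cards2P[a [b [nab ->]]] card_f nef.
have shared x y : [set x; y] != f -> x != y -> x \in f ->
  (sepn n 1 * #|[set F in forests n | ([set x; y] \in F) && (f \in F)]| <
   sepn n 2 ^ 2)%N.
  move=> ne nxy xf.
  have [z [nxz Ef]] : exists z, x != z /\ f = [set x; z].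
    have /cards1P[z Ez] : #|f :\ x| == 1%N.
      by move: card_f; rewrite (cardsD1 x f) xf add1n eqSS.
    exists z; rewrite -(setD1K xf) Ez; split=> //.
    by have := set11 z; rewrite -Ez !inE eq_sym => /andP[].
  rewrite Ef in ne *; rewrite card_adjacent_edges ?adjacent_edges_bound //.
  rewrite /= !inE negb_or nxy nxz /= andbT.
  by apply: contraNneq ne => ->.
have [af|naf] := boolP (a \in f); first exact: shared.
have [bf|nbf] := boolP (b \in f).
  by rewrite setUC; apply: shared; rewrite // 1?setUC // eq_sym.
have /cards2P[c [d [ncd Ef]]] := card_f.
move: naf nbf; rewrite Ef !inE !negb_or => /andP[nac nad] /andP[nbc nbd].
have U : uniq [:: a; b; c; d].
  by rewrite /= !inE !negb_or nab nac nad nbc nbd ncd.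
rewrite card_disjoint_edges // disjoint_edges_bound //.
by have := max_card (mem [:: a; b; c; d]); rewrite (card_uniqP U) card_ord.
Qed.

Theorem corollary7p3 (n : nat) (hn : (3 <= n)%N) (e f : {set 'I_n})
    (he : e \in Kn_edges n) (hf : f \in Kn_edges n) (hef : e != f) :
  forest_prob (fun F : {set {set 'I_n}} => (e \in F) && (f \in F)) <
  forest_prob (fun F : {set {set 'I_n}} => e \in F) *
  forest_prob (fun F : {set {set 'I_n}} => f \in F).
Proof.
have one_edge g : g \in Kn_edges n -> #|[set F in forests n | g \in F]| = sepn n 2.
  by rewrite inE => /cards2P[a [b [nab ->]]]; apply: card_one_edge.
have total : #|forests n| = sepn n 1.
  transitivity (@separating n [::]).
    by apply: eq_card => F; rewrite !inE andbT.
  rewrite separating_size // sepn_rec ?mul0n ?addn0 //.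
  exact: ltnW (ltnW hn).
rewrite /forest_prob !one_edge // total mulf_div.
have N_gt0 : 0 < (sepn n 1)%:R :> rat by rewrite ltr0n sepn_gt0.
rewrite ltr_pdivrMr // mulrAC ltr_pdivlMr ?mulr_gt0 //.
rewrite mulrA ltr_pM2r // -!natrM ltr_nat mulnC mulnn.
exact: card_edge_pair_bound.
Qed.
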